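(* For every real $\nu>-1$, the first positive zero $j_{\nu,1}$ of the Bessel function $J_\nu$ satisfies $$2^{\frac56}\,\sqrt{\nu+1}\,\sqrt[6]{(\nu+2)(\nu+3)}<j_{\nu,1}<\sqrt{2(\nu+1)(\nu+3)}.$$
   Context: $J_\nu$ is the Bessel function of the first kind of order $\nu$, and $j_{\nu,1}$ denotes its smallest positive zero. *)

(* Defs.v *)
(* World: Stdlib reals with Coquelicot. *)
From Stdlib Require Import Reals Factorial.
From Coquelicot Require Import Coquelicot.
Open Scope R_scope.

(* Euler's integral of t^(s-1) e^(-t) over (0, +oo), improper at both ends.
   It represents the Gamma function for s > 0 only, which covers every
   argument m + nu + 1 occurring below when nu > -1. *)
Definition Gamma (s : R) : R :=
  RInt_gen (fun t => Rpower t (s - 1) * exp (- t))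
           (at_right 0) (Rbar_locally p_infty).

(* J_nu(x) = sum_m (-1)^m / (m! Gamma(m + nu + 1)) (x/2)^(2m + nu).
   Meaningful for nu > -1 and x > 0: Rpower is the real power only on
   positive bases. *)
Definition BesselJ (nu x : R) : R :=
  Series (fun m : nat =>
    (-1) ^ m / (INR (fact m) * Gamma (INR m + nu + 1))
    * Rpower (x / 2) (2 * INR m + nu)).

(* j = j_{nu,1} *)
Definition is_first_positive_zero (nu j : R) : Prop :=
  0 < j /\ BesselJ nu j = 0 /\
  forall x : R, 0 < x -> BesselJ nu x = 0 -> j <= x.

Lemma first_positive_zero_unique (nu j j' : R) :
  is_first_positive_zero nu j -> is_first_positive_zero nu j' -> j = j'.
Proof.
  intros [p [z m]] [p' [z' m']].
  apply Rle_antisym; auto.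
Qed.

(* Main.v *)
Require Import Defs.
From Stdlib Require Import Reals Lra Lia Factorial Classical_Prop.
From Coquelicot Require Import Coquelicot.
Open Scope R_scope.

(** With [a = nu + 1] and [z = x^2 / 4], the functional equation of Gamma gives
    [J_nu(x) = (x/2)^nu / Gamma(a) * F(z)], where [F] is the entire solution
    of [z F'' + a F' + F = 0] with [F(0) = 1] ([BesselJ_eq], [bessel_F_ode]).
    So [j^2 / 4] is the first positive zero of [F], and it has to be located
    between [b], where [b^3 = a^3 (a+1)(a+2) / 2], and [R = a (a+2) / 2].

    These are the Euler-Rayleigh bounds.  Let [g_k = sum_n z_n^(-k-1)] run over
    the zeros of [F]; then [- F'/F = g_0 + g_1 z + g_2 z^2 + ...], and
    [b^3 = 1 / g_2], [R = g_1 / g_2].  Replacing the tail of this series by a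
    geometric one with the ratio that the bound suggests yields
    [h = g_0 + g_1 z / (1 - z/R)] and
    [h = g_0 + g_1 z + g_2 z^2 / (1 - z/b)], a minorant and a majorant of
    [- F'/F].  The function [F] itself is then compared with the explicit
    solution [w] of [- w'/w = h], by Sturm's method.  From
    [(z^a (F' w - F w'))' = - z^(a-1) F (z w'' + a w' + w)]
    ([wronskian_identity]), everything depends on the sign of
    [z w'' + a w' + w].

    For the upper bound, [w = exp(-k z) (R - z)^c] with [c > 1], this sign is
    positive on [(0, R)], while the Wronskian vanishes at both ends of the
    interval; by Rolle's theorem [F] has a zero inside
    ([bessel_F_zero_below]), which also proves that a first zero exists.
    For the lower bound, [w = (b - z) exp(- k z - m z^2 / 2)], the sign is
    negative; if the first zero of [F] were at most [b], the Wronskian at that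
    zero would have to be positive, but it is not ([bessel_F_zero_above]). *)

(** * Preliminaries from real analysis *)

Lemma Rpower_pos (x y : R) : 0 < Rpower x y.
Proof. apply exp_pos. Qed.

Lemma ball_bounds (x e y : R) : ball x e y <-> - e < y - x < e.
Proof.
  change (Rabs (y - x) < e <-> - e < y - x < e). split; intros h.
  - apply Rabs_def2 in h. lra.
  - apply Rabs_def1; lra.
Qed.

Lemma locally_pos (z : R) : 0 < z -> locally z (fun t => 0 < t).
Proof.
  intros hz. exists (mkposreal z hz). intros y hy.
  apply ball_bounds in hy. simpl in hy. lra.
Qed.

Lemma at_right_0_interval (d : R) : 0 < d -> at_right 0 (fun t => 0 < t < d).
Proof.
  intros hd. exists (mkposreal d hd). intros y hy hy0.
  apply ball_bounds in hy. simpl in hy. lra.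
Qed.

Lemma is_derive_Rpower (y x : R) :
  0 < x -> is_derive (fun t => Rpower t y) x (y * Rpower x (y - 1)).
Proof. intros hx; apply is_derive_Reals, derivable_pt_lim_power, hx. Qed.

Lemma Rpower_pred (x y : R) : 0 < x -> Rpower x y = x * Rpower x (y - 1).
Proof.
  intros hx. replace y with (1 + (y - 1)) at 1 by ring.
  rewrite Rpower_plus, Rpower_1; [reflexivity | exact hx].
Qed.

Lemma Rpower_small (s eps : R) :
  0 < s -> 0 < eps ->
  exists d : posreal, forall t, 0 < t < d -> Rpower t s < eps.
Proof.
  intros hs he.
  exists (mkposreal _ (Rpower_pos eps (/ s))). simpl. intros t ht.
  replace eps with (Rpower (Rpower eps (/ s)) s).
  - apply Rlt_Rpower_l; lra.
  - rewrite Rpower_mult, Rinv_l, Rpower_1; lra.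
Qed.

(** Power function extended by 0 to the nonpositive half-line, so that it is
    continuous on the whole line for positive exponents; [Rpower 0 a] is
    positive. *)
Definition rpow (a z : R) : R := if Rlt_dec 0 z then Rpower z a else 0.

Lemma rpow_pos_eq (a z : R) : 0 < z -> rpow a z = Rpower z a.
Proof. intros hz. unfold rpow. destruct (Rlt_dec 0 z); [reflexivity | lra]. Qed.

Lemma rpow_0 (a : R) : rpow a 0 = 0.
Proof. unfold rpow. destruct (Rlt_dec 0 0); [lra | reflexivity]. Qed.

Lemma rpow_derive (a z : R) :
  0 < z -> is_derive (rpow a) z (a * rpow (a - 1) z).
Proof.
  intros hz. rewrite rpow_pos_eq by exact hz.
  apply is_derive_ext_loc with (fun t => Rpower t a).
  - apply filter_imp with (2 := locally_pos z hz).
    intros t ht. symmetry. apply rpow_pos_eq, ht.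
  - apply is_derive_Rpower, hz.
Qed.

Lemma rpow_continuous (a z : R) : 0 < a -> continuous (rpow a) z.
Proof.
  intros ha. destruct (Rlt_dec 0 z) as [hz|hz].
  - apply (ex_derive_continuous (rpow a)). eexists. apply rpow_derive, hz.
  - assert (e : rpow a z = 0) by (unfold rpow; destruct (Rlt_dec 0 z); [lra | reflexivity]).
    unfold continuous. rewrite e. apply filterlim_locally. intros eps.
    destruct (Rpower_small a eps ha (cond_pos eps)) as [d hd].
    exists d. intros y hy.
    apply ball_bounds in hy. apply ball_bounds. destruct eps as [eps he]; simpl in *.
    unfold rpow. destruct (Rlt_dec 0 y) as [hy0|hy0].
    + generalize (hd y ltac:(lra)) (Rpower_pos y a). lra.
    + lra.
Qed.

(** Unlike [MVT_gen], this places the intermediate point strictly inside the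
    interval, where the Wronskian below is differentiable and its derivative
    can have a strict sign. *)
Lemma mean_value_open (f f' : R -> R) (a b : R) :
  a < b ->
  (forall x, a < x < b -> is_derive f x (f' x)) ->
  (forall x, a <= x <= b -> continuous f x) ->
  exists c, a < c < b /\ f b - f a = (b - a) * f' c.
Proof.
  intros hab hd hc.
  assert (pr1 : forall c, a < c < b -> derivable_pt f c).
  { intros c h. exists (f' c). apply is_derive_Reals, hd, h. }
  destruct (MVT f id a b pr1 (fun c _ => derivable_pt_id c) hab)
    as (c & hcab & e).
  - intros c h. apply continuity_pt_filterlim, hc, h.
  - intros c _. apply derivable_continuous_pt, derivable_pt_id.
  - exists c. split; [exact hcab|].
    rewrite derive_pt_id in e.
    rewrite (derive_pt_eq_0 f c (f' c)) in e by apply is_derive_Reals, hd, hcab.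
    unfold id in e. lra.
Qed.

(** The zero is the supremum of the [x] such that [f] is positive on [0, x]. *)
Lemma first_zero (f : R -> R) (b : R) :
  (forall x, continuous f x) -> 0 < f 0 -> 0 < b -> f b = 0 ->
  exists z, 0 < z <= b /\ f z = 0 /\ forall x, 0 <= x < z -> 0 < f x.
Proof.
  intros hc h0 hb hfb.
  assert (near : forall x, f x <> 0 -> exists d, 0 < d /\
    forall y, Rabs (y - x) < d -> 0 < f y * f x).
  { intros x hx.
    assert (hq : 0 < f x * f x) by nra.
    assert (c2 : continuous (fun y => f y * f x) x)
      by (apply (continuous_mult f (fun _ => f x)); [apply hc | apply continuous_const]).
    destruct (c2 _ (locally_pos _ hq)) as [d hd].
    exists d. split; [apply cond_pos|]. intros y hy. apply hd, hy. }
  destruct (completeness (fun x => 0 <= x /\ forall y, 0 <= y <= x -> 0 < f y)) as [z [hub hlub]].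
  { exists b. intros x [hx hp]. destruct (Rle_lt_dec x b) as [h|h]; [exact h|].
    specialize (hp b ltac:(lra)). lra. }
  { exists 0. split; [lra|]. intros y hy. replace y with 0 by lra. exact h0. }
  assert (hpos : forall x, 0 <= x < z -> 0 < f x).
  { intros x hx. apply Rnot_le_lt. intros hn.
    assert (z <= x); [|lra].
    apply hlub. intros t [ht hp]. apply Rnot_lt_le. intros hxt.
    specialize (hp x ltac:(lra)). lra. }
  assert (hz0 : 0 <= z).
  { apply hub. split; [lra|]. intros y hy. replace y with 0 by lra. exact h0. }
  assert (hfz : f z = 0).
  { destruct (Req_dec (f z) 0) as [h|h]; [exact h|exfalso].
    destruct (near z h) as (d & hd & hn).
    destruct (Rlt_dec 0 (f z)) as [hp|hp].
    - assert (z + d / 2 <= z); [|lra].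
      apply hub. split; [lra|]. intros y hy.
      destruct (Rlt_dec y z) as [hyz|hyz]; [apply hpos; lra|].
      assert (0 < f y * f z) by (apply hn, Rabs_def1; lra). nra.
    - assert (hz : 0 < z).
      { destruct hz0 as [hz|<-]; [exact hz|lra]. }
      set (y := Rmax 0 (z - d / 2)).
      assert (hy : 0 <= y < z /\ Rabs (y - z) < d).
      { unfold y, Rmax. destruct (Rle_dec 0 (z - d / 2)); split; try apply Rabs_def1; lra. }
      destruct hy as [hy1 hy2]. specialize (hn y hy2). specialize (hpos y hy1). nra. }
  exists z. repeat split; try assumption.
  - destruct hz0 as [hz|hz]; [exact hz|]. rewrite <- hz in hfz. lra.
  - apply Rnot_lt_le. intros hbz. specialize (hpos b ltac:(lra)). lra.
Qed.

(** * Convergence and functional equation of Euler's integral *)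

Definition gamma_integrand (s t : R) : R := Rpower t (s - 1) * exp (- t).

(** With [q = t / (2 s)], the bound amounts to [ln q <= q]. *)
Lemma Rpower_exp_bound (s t : R) :
  0 < s -> 0 < t ->
  Rpower t s * exp (- t) <= Rpower (2 * s) s * exp (- t / 2).
Proof.
  intros hs ht.
  assert (h : Rpower t s <= Rpower (2 * s) s * exp (t / 2)).
  { replace t with (2 * s * (t / (2 * s))) at 1 by (field; lra).
    assert (hq : 0 < t / (2 * s)) by (apply Rdiv_lt_0_compat; lra).
    rewrite <- Rpower_mult_distr by lra.
    apply Rmult_le_compat_l; [left; apply Rpower_pos|].
    replace (t / 2) with (s * (t / (2 * s))) by (field; lra).
    unfold Rpower. set (q := t / (2 * s)) in *.
    assert (hl : ln q <= q).
    { rewrite <- (ln_exp q) at 2. apply ln_le; [exact hq|].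
      generalize (exp_ineq1_le q); lra. }
    apply Rmult_le_compat_l with (r := s) in hl; [|lra].
    destruct hl as [hl | ->]; [left; apply exp_increasing, hl | right; reflexivity]. }
  replace (- t / 2) with (t / 2 + - t) by field.
  rewrite exp_plus, <- Rmult_assoc.
  apply Rmult_le_compat_r; [left; apply exp_pos | exact h].
Qed.

Lemma is_derive_Rpower_exp (s t : R) :
  0 < t ->
  is_derive (fun x => Rpower x s * exp (- x)) t
    (s * gamma_integrand s t - gamma_integrand (s + 1) t).
Proof.
  intros ht.
  evar_last.
  - apply @is_derive_mult; [apply is_derive_Rpower, ht | | intros; apply Rmult_comm].
    apply (is_derive_comp exp (fun x => - x)); [apply is_derive_exp|].
    auto_derive; [exact I | reflexivity].
  - unfold gamma_integrand, mult, plus, scal, mult; simpl; unfold mult; simpl.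
    replace (s + 1 - 1) with s by ring. ring.
Qed.

Lemma gamma_integrand_pos (s t : R) : 0 < gamma_integrand s t.
Proof. apply Rmult_lt_0_compat; [apply Rpower_pos | apply exp_pos]. Qed.

Lemma gamma_integrand_continuous (s t : R) :
  0 < t -> continuous (gamma_integrand s) t.
Proof.
  intros ht. apply (ex_derive_continuous (gamma_integrand s)).
  apply ex_derive_mult.
  - eexists; apply is_derive_Rpower, ht.
  - auto_derive; exact I.
Qed.

Lemma gamma_integrand_ex_RInt (s u v : R) :
  0 < u -> 0 < v -> ex_RInt (gamma_integrand s) u v.
Proof.
  intros hu hv. apply (@ex_RInt_continuous R_CompleteNormedModule). intros t ht.
  apply gamma_integrand_continuous.
  revert ht. unfold Rmin. destruct (Rle_dec u v); lra.
Qed.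

Lemma RInt_Rpower_exp (s u v : R) :
  0 < u -> 0 < v ->
  is_RInt (fun t => s * gamma_integrand s t - gamma_integrand (s + 1) t) u v
    (Rpower v s * exp (- v) - Rpower u s * exp (- u)).
Proof.
  intros hu hv.
  assert (hm : forall t, Rmin u v <= t -> 0 < t).
  { intros t. unfold Rmin. destruct (Rle_dec u v); lra. }
  apply (is_RInt_derive (fun x => Rpower x s * exp (- x))).
  - intros t ht. apply is_derive_Rpower_exp, hm, ht.
  - intros t ht.
    apply (continuous_minus (fun t => s * gamma_integrand s t)).
    + apply (continuous_scal_r s (gamma_integrand s)).
      apply gamma_integrand_continuous, hm, ht.
    + apply gamma_integrand_continuous, hm, ht.
Qed.

(** Integration by parts trades [t^(s-1) e^(-t)] for [t^s e^(-t) / s]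
    plus boundary terms.  The new integrand is bounded by a multiple of
    [e^(-t/2)] on all of [(0, +oo)], so the singularity at 0 and the tail are
    treated at once. *)
Lemma RInt_gamma_integrand_bound (s u v : R) :
  0 < s -> 0 < u <= v ->
  RInt (gamma_integrand s) u v <= 3 * (Rpower (2 * s) s / s).
Proof.
  intros hs [hu huv].
  set (K := Rpower (2 * s) s).
  assert (hK : 0 < K) by apply Rpower_pos.
  assert (hexp : forall t, 0 < t -> 0 < exp (- t / 2) < 1).
  { intros t ht; split; [apply exp_pos|].
    rewrite <- exp_0. apply exp_increasing. lra. }
  assert (hIe : is_RInt (fun t => K * exp (- t / 2)) u v
                  (- (2 * K) * exp (- v / 2) - - (2 * K) * exp (- u / 2))).
  { apply (is_RInt_derive (fun t => - (2 * K) * exp (- t / 2))).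
    - intros t _. auto_derive; [exact I|]. unfold Rdiv. field.
    - intros t _. apply (ex_derive_continuous (fun t => K * exp (- t / 2))).
      auto_derive. exact I. }
  assert (hIs := RInt_correct _ _ _ (gamma_integrand_ex_RInt s u v hu ltac:(lra))).
  assert (hI1 := RInt_correct _ _ _ (gamma_integrand_ex_RInt (s + 1) u v hu ltac:(lra))).
  set (A := RInt (gamma_integrand s) u v) in *.
  set (B := RInt (gamma_integrand (s + 1)) u v) in *.
  assert (hB : B <= - (2 * K) * exp (- v / 2) - - (2 * K) * exp (- u / 2)).
  { apply (is_RInt_le (gamma_integrand (s + 1)) (fun t => K * exp (- t / 2)) u v);
      [lra | exact hI1 | exact hIe |].
    intros t ht. unfold gamma_integrand.
    replace (s + 1 - 1) with s by ring. apply Rpower_exp_bound; lra. }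
  assert (hAB : s * A - B = Rpower v s * exp (- v) - Rpower u s * exp (- u)).
  { rewrite <- (is_RInt_unique _ _ _ _ (RInt_Rpower_exp s u v hu ltac:(lra))).
    symmetry. apply is_RInt_unique.
    apply (is_RInt_minus (V := R_NormedModule) (fun t => s * gamma_integrand s t)
             (gamma_integrand (s + 1)) u v (s * A) B); [|exact hI1].
    apply (is_RInt_scal (V := R_NormedModule) (gamma_integrand s) u v s A hIs). }
  generalize (hexp u hu) (hexp v ltac:(lra)) (Rpower_exp_bound s v hs ltac:(lra)).
  fold K. intros h1 h2 h3.
  assert (h4 : 0 < Rpower u s * exp (- u))
    by (apply Rmult_lt_0_compat; [apply Rpower_pos | apply exp_pos]).
  apply Rmult_le_reg_l with s; [exact hs|].
  replace (s * (3 * (K / s))) with (3 * K) by (field; lra).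
  nra.
Qed.

(** Integrals over [[u, v]] grow in both directions, so the improper integral
    is their supremum. *)
Lemma is_RInt_gen_of_bounded (f : R -> R) (M : R) :
  (forall t, 0 < t -> 0 < f t) ->
  (forall t, 0 < t -> continuous f t) ->
  (forall u v, 0 < u <= v -> RInt f u v <= M) ->
  exists l, 0 < l /\ is_RInt_gen f (at_right 0) (Rbar_locally p_infty) l.
Proof.
  intros fpos fcont hM.
  assert (hex : forall u v, 0 < u <= v -> ex_RInt f u v).
  { intros u v huv. apply (@ex_RInt_continuous R_CompleteNormedModule). intros t ht.
    apply fcont. rewrite Rmin_left in ht; lra. }
  destruct (completeness (fun x => exists u v, 0 < u <= v /\ x = RInt f u v))
    as [l [hub hlub]].
  { exists M. intros x (u & v & huv & ->). apply hM, huv. }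
  { exists (RInt f 1 1), 1, 1. split; [lra | reflexivity]. }
  exists l. split.
  { apply Rlt_le_trans with (RInt f 1 2).
    - apply RInt_gt_0; [lra | intros; apply fpos; lra | intros; apply fcont; lra].
    - apply hub. exists 1, 2. split; [lra | reflexivity]. }
  apply (filterlimi_lim_ext_loc (fun ab => RInt f (fst ab) (snd ab))).
  { apply (Filter_prod _ _ _ (fun u => 0 < u < 1) (fun v => 1 < v)).
    - apply at_right_0_interval, Rlt_0_1.
    - exists 1. intros; assumption.
    - intros u v hu hv; simpl. apply @RInt_correct, hex. lra. }
  apply filterlim_locally. intros eps.
  assert (hx : exists u0 v0, 0 < u0 <= v0 /\ l - eps < RInt f u0 v0).
  { apply NNPP. intros hn.
    assert (l <= l - eps); [|destruct eps; simpl in *; lra].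
    apply hlub. intros x (u & v & huv & ->).
    destruct (Rle_lt_dec (RInt f u v) (l - eps)) as [h|h]; [exact h|].
    exfalso. apply hn. exists u, v. split; assumption. }
  destruct hx as (u0 & v0 & huv0 & hl).
  apply (Filter_prod _ _ _ (fun u => 0 < u < u0) (fun v => v0 < v)).
  - apply at_right_0_interval, huv0.
  - exists v0. intros; assumption.
  - intros u v hu hv; simpl.
    assert (h1 : RInt f u v <= l).
    { apply hub. exists u, v. split; [lra | reflexivity]. }
    assert (h2 : RInt f u0 v0 <= RInt f u v).
    { rewrite <- (RInt_Chasles f u u0 v) by (apply hex; lra).
      rewrite <- (RInt_Chasles f u0 v0 v) by (apply hex; lra).
      unfold plus; simpl.
      assert (0 <= RInt f u u0)
        by (apply RInt_ge_0; [lra | apply hex; lra | intros; left; apply fpos; lra]).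
      assert (0 <= RInt f v0 v)
        by (apply RInt_ge_0; [lra | apply hex; lra | intros; left; apply fpos; lra]).
      lra. }
    apply ball_bounds; destruct eps; simpl in *; lra.
Qed.

Lemma Gamma_integral (s : R) :
  0 < s ->
  0 < Gamma s /\
  is_RInt_gen (gamma_integrand s) (at_right 0) (Rbar_locally p_infty) (Gamma s).
Proof.
  intros hs.
  destruct (is_RInt_gen_of_bounded (gamma_integrand s) (3 * (Rpower (2 * s) s / s)))
    as (l & hl & hI).
  - intros; apply gamma_integrand_pos.
  - intros; apply gamma_integrand_continuous; assumption.
  - intros; apply RInt_gamma_integrand_bound; assumption.
  - assert (h : Gamma s = l) by exact (is_RInt_gen_unique _ _ hI).
    rewrite h. split; assumption.
Qed.

Lemma Rpower_exp_lim_0 (s : R) :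
  0 < s -> filterlim (fun t => Rpower t s * exp (- t)) (at_right 0) (locally 0).
Proof.
  intros hs. apply filterlim_locally. intros eps.
  destruct (Rpower_small s eps hs (cond_pos eps)) as [d hd].
  exists d. intros t ht ht0.
  apply ball_bounds in ht. specialize (hd t ltac:(lra)).
  assert (exp (- t) < 1) by (rewrite <- exp_0; apply exp_increasing; lra).
  generalize (Rpower_pos t s) (exp_pos (- t)); intros.
  apply ball_bounds; nra.
Qed.

Lemma Rpower_exp_lim_infty (s : R) :
  0 < s ->
  filterlim (fun t => Rpower t s * exp (- t)) (Rbar_locally p_infty) (locally 0).
Proof.
  intros hs.
  apply (filterlim_le_le (F := Rbar_locally p_infty) (fun _ => 0) _
           (fun t => Rpower (2 * s) s * exp (- t / 2)) 0).
  - exists 0. intros t ht. split.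
    + apply Rmult_le_pos; left; [apply Rpower_pos | apply exp_pos].
    + apply Rpower_exp_bound; assumption.
  - apply filterlim_const.
  - replace (Rbar_locally 0) with (Rbar_locally (Rbar_mult (Rpower (2 * s) s) 0))
      by (simpl; now rewrite Rmult_0_r).
    apply (is_lim_scal_l (fun t => exp (- t / 2)) _ p_infty 0).
    apply (is_lim_comp exp (fun t => - t / 2) p_infty 0 m_infty).
    + apply is_lim_exp_m.
    + apply is_lim_ext with (fun t => (- / 2) * t); [intros; field|].
      replace m_infty with (Rbar_mult (- / 2) p_infty).
      * apply is_lim_scal_l, is_lim_id.
      * unfold Rbar_mult; simpl. case Rle_dec; [intros h; exfalso; lra | reflexivity].
    + exists 0. intros; discriminate.
Qed.

(** The derivative of [t^s e^(-t)] has integral 0, since the function vanishes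
    at both ends. *)
Lemma Gamma_succ (s : R) : 0 < s -> Gamma (s + 1) = s * Gamma s.
Proof.
  intros hs.
  destruct (Gamma_integral s hs) as [_ h0].
  destruct (Gamma_integral (s + 1) ltac:(lra)) as [_ h1].
  assert (hd := is_RInt_gen_minus _ _ _ _ (is_RInt_gen_scal _ s _ h0) h1).
  assert (h : is_RInt_gen (fun t => s * gamma_integrand s t - gamma_integrand (s + 1) t)
     (at_right 0) (Rbar_locally p_infty) 0).
  { apply (filterlimi_lim_ext_loc (fun ab => Rpower (snd ab) s * exp (- snd ab)
               - Rpower (fst ab) s * exp (- fst ab))).
    - apply (Filter_prod _ _ _ (fun u => 0 < u) (fun v => 0 < v)).
      + exists (mkposreal 1 Rlt_0_1). intros; assumption.
      + exists 0. intros; assumption.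
      + intros u v hu hv. apply RInt_Rpower_exp; assumption.
    - assert (e0 : 0 + - 0 = 0) by ring. rewrite <- e0 at 2.
      apply (filterlim_comp_2 (fun ab : R * R => Rpower (snd ab) s * exp (- snd ab))
               (fun ab : R * R => - (Rpower (fst ab) s * exp (- fst ab))) Rplus
               (G := locally 0) (H := locally (- 0))).
      + apply (filterlim_comp _ _ _ snd (fun t => Rpower t s * exp (- t))
                 _ (Rbar_locally p_infty) _ filterlim_snd), Rpower_exp_lim_infty, hs.
      + apply (filterlim_comp _ _ _ (fun ab : R * R => Rpower (fst ab) s * exp (- fst ab)) Ropp
                 _ (locally 0) _).
        * apply (filterlim_comp _ _ _ fst (fun t => Rpower t s * exp (- t))
                   _ (at_right 0) _ filterlim_fst), Rpower_exp_lim_0, hs.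
        * apply (filterlim_opp (V := R_NormedModule) 0).
      + apply (filterlim_plus (V := R_NormedModule) 0 (- 0)). }
  assert (e1 := is_RInt_gen_unique _ _ h).
  assert (e2 := is_RInt_gen_unique _ _ hd).
  unfold minus, plus, opp, scal in e2; simpl in e2; unfold mult in e2; simpl in e2.
  unfold Rminus in e1. rewrite e1 in e2. lra.
Qed.

(** * The Bessel series and its differential equation *)

(** The coefficients [(-1)^n / (n! a (a+1) ... (a+n-1))] of the hypergeometric
    series [0F1(; a; -z)], by the recurrence that expresses the differential
    equation. *)
Fixpoint bessel_coef (a : R) (n : nat) : R :=
  match n with
  | O => 1
  | S k => - bessel_coef a k / (INR (S k) * (a + INR k))
  end.

Definition bessel_F (a : R) : R -> R := PSeries (bessel_coef a).
Definition bessel_F' (a : R) : R -> R := PSeries (PS_derive (bessel_coef a)).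
Definition bessel_F'' (a : R) : R -> R :=
  PSeries (PS_derive (PS_derive (bessel_coef a))).

Lemma bessel_coef_neq_0 (a : R) (n : nat) : 0 < a -> bessel_coef a n <> 0.
Proof.
  intros ha. induction n as [|n IH]; [exact R1_neq_R0|].
  cbn [bessel_coef]. generalize (pos_INR n) (lt_0_INR (S n) ltac:(lia)). intros h1 h2.
  unfold Rdiv. apply Rmult_integral_contrapositive_currified; [lra|].
  apply Rinv_neq_0_compat, Rgt_not_eq, Rmult_lt_0_compat; lra.
Qed.

Lemma bessel_coef_radius (a : R) :
  0 < a -> CV_radius (bessel_coef a) = p_infty.
Proof.
  intros ha. apply CV_radius_infinite_DAlembert.
  { intros n. apply bessel_coef_neq_0, ha. }
  apply is_lim_seq_le_le_loc with (fun _ => 0) (fun n => / a * / (INR n + 1)).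
  - exists 0%nat. intros n _. split; [apply Rabs_pos|].
    assert (hc := bessel_coef_neq_0 a n ha).
    generalize (pos_INR n). intros hn.
    cbn [bessel_coef]. rewrite S_INR.
    replace (- bessel_coef a n / ((INR n + 1) * (a + INR n)) / bessel_coef a n)
      with (- (/ (a + INR n) * / (INR n + 1))) by (field; repeat split; lra).
    rewrite Rabs_Ropp, Rabs_pos_eq.
    + apply Rmult_le_compat_r; [left; apply Rinv_0_lt_compat; lra|].
      apply Rinv_le_contravar; lra.
    + apply Rmult_le_pos; left; apply Rinv_0_lt_compat; lra.
  - apply is_lim_seq_const.
  - replace (Finite 0) with (Rbar_mult (/ a) 0) by (simpl; now rewrite Rmult_0_r).
    apply is_lim_seq_scal_l.
    apply (is_lim_seq_inv _ p_infty); [|discriminate].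
    apply is_lim_seq_ext with (fun n => INR (S n)); [intros; apply S_INR|].
    apply (is_lim_seq_incr_1 INR), is_lim_seq_INR.
Qed.

Lemma bessel_F_derive (a z : R) :
  0 < a -> is_derive (bessel_F a) z (bessel_F' a z).
Proof.
  intros ha. apply is_derive_PSeries. now rewrite bessel_coef_radius.
Qed.

Lemma bessel_F'_derive (a z : R) :
  0 < a -> is_derive (bessel_F' a) z (bessel_F'' a z).
Proof.
  intros ha. apply is_derive_PSeries. now rewrite CV_radius_derive, bessel_coef_radius.
Qed.

Lemma bessel_F_0 (a : R) : bessel_F a 0 = 1.
Proof. apply PSeries_0. Qed.

Lemma bessel_F_ode (a z : R) :
  0 < a -> z * bessel_F'' a z + a * bessel_F' a z + bessel_F a z = 0.
Proof.
  intros ha. unfold bessel_F, bessel_F', bessel_F''.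
  set (c := bessel_coef a).
  assert (hr : CV_radius c = p_infty) by apply bessel_coef_radius, ha.
  assert (h0 : ex_pseries c z) by (apply CV_radius_inside; now rewrite hr).
  assert (h1 : ex_pseries (PS_derive c) z)
    by (apply CV_radius_inside; now rewrite CV_radius_derive, hr).
  assert (h2 : ex_pseries (PS_derive (PS_derive c)) z)
    by (apply CV_radius_inside; now rewrite !CV_radius_derive, hr).
  apply ex_pseries_incr_1 in h2.
  rewrite <- PSeries_incr_1, <- PSeries_scal, <- !PSeries_plus; try assumption.
  - rewrite <- (PSeries_const_0 z). apply PSeries_ext. intros n.
    assert (hrec : c (S n) = - c n / (INR (S n) * (a + INR n))) by reflexivity.
    generalize (pos_INR n). intros hn.
    destruct n as [|n].
    + change (0 + a * (INR 1 * c 1%nat) + c 0%nat = 0). rewrite hrec. simpl. field. lra.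
    + change (INR (S n) * (INR (S (S n)) * c (S (S n)))
              + a * (INR (S (S n)) * c (S (S n))) + c (S n) = 0).
      rewrite hrec, (S_INR (S n)). field. lra.
  - now apply (ex_pseries_plus (V := R_NormedModule));
      [|apply (ex_pseries_scal (V := R_NormedModule)); [apply Rmult_comm|]].
  - now apply (ex_pseries_scal (V := R_NormedModule)); [apply Rmult_comm|].
Qed.

Lemma Gamma_shift (a : R) (n : nat) :
  0 < a ->
  (-1) ^ n / (INR (fact n) * Gamma (INR n + a)) = bessel_coef a n / Gamma a.
Proof.
  intros ha. induction n as [|n IH].
  - simpl. rewrite Rplus_0_l, Rmult_1_l. reflexivity.
  - cbn [bessel_coef]. generalize (pos_INR n) (INR_fact_neq_0 n). intros hn hf.
    destruct (Gamma_integral (INR n + a) ltac:(lra)) as [hG _].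
    destruct (Gamma_integral a ha) as [hGa _].
    rewrite fact_simpl, mult_INR, <- tech_pow_Rmult.
    replace (INR (S n) + a) with (INR n + a + 1) by (rewrite S_INR; ring).
    rewrite Gamma_succ by lra.
    replace (- bessel_coef a n / (INR (S n) * (a + INR n)) / Gamma a)
      with (- (bessel_coef a n / Gamma a) / (INR (S n) * (a + INR n)))
      by (rewrite S_INR; field; repeat split; lra).
    rewrite <- IH, S_INR. field. repeat split; lra.
Qed.

Lemma BesselJ_eq (nu x : R) :
  -1 < nu -> 0 < x ->
  BesselJ nu x = Rpower (x / 2) nu / Gamma (nu + 1) * bessel_F (nu + 1) (x ^ 2 / 4).
Proof.
  intros hnu hx. unfold BesselJ, bessel_F, PSeries.
  rewrite <- Series_scal_l. apply Series_ext. intros n.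
  rewrite Rplus_assoc, Gamma_shift by lra.
  rewrite Rpower_plus.
  replace (Rpower (x / 2) (2 * INR n)) with ((x ^ 2 / 4) ^ n).
  - unfold Rdiv; ring.
  - rewrite <- Rpower_mult.
    replace (Rpower (x / 2) 2) with (x ^ 2 / 4).
    + rewrite Rpower_pow; [reflexivity|]. nra.
    + replace 2 with (INR 2) at 2 by reflexivity.
      rewrite Rpower_pow by lra. field.
Qed.

Lemma BesselJ_zero_iff (nu x : R) :
  -1 < nu -> 0 < x ->
  (BesselJ nu x = 0 <-> bessel_F (nu + 1) (x ^ 2 / 4) = 0).
Proof.
  intros hnu hx. rewrite BesselJ_eq by assumption.
  assert (h : Rpower (x / 2) nu / Gamma (nu + 1) <> 0).
  { apply Rgt_not_eq, Rdiv_lt_0_compat; [apply Rpower_pos|].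
    apply Gamma_integral. lra. }
  split; intros H.
  - apply Rmult_integral in H. tauto.
  - rewrite H. apply Rmult_0_r.
Qed.

(** * Sturm comparison *)

(** The mean value theorem on [[0, b]] for the Wronskian
    [z^a (F' w - F w')], which vanishes at 0 because [a > 0]. The factor
    [z^a] makes the equation of [F] self-adjoint, so that the first
    derivatives cancel. *)
Lemma wronskian_identity (a b : R) (w w' w'' : R -> R) :
  0 < a -> 0 < b ->
  (forall z, 0 < z < b -> is_derive w z (w' z)) ->
  (forall z, 0 < z < b -> is_derive w' z (w'' z)) ->
  (forall z, 0 <= z <= b -> continuous w z) ->
  (forall z, 0 <= z <= b -> continuous w' z) ->
  exists z, 0 < z < b /\
    Rpower b a * (bessel_F' a b * w b - bessel_F a b * w' b)
    = - (b * Rpower z (a - 1) * bessel_F a z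
         * (z * w'' z + a * w' z + w z)).
Proof.
  intros ha hb hw hw' cw cw'.
  set (W := fun z => rpow a z * (bessel_F' a z * w z - bessel_F a z * w' z)).
  assert (cF : forall z, continuous (bessel_F a) z)
    by (intros z; apply (ex_derive_continuous (bessel_F a)); eexists;
        apply bessel_F_derive, ha).
  assert (cF' : forall z, continuous (bessel_F' a) z)
    by (intros z; apply (ex_derive_continuous (bessel_F' a)); eexists;
        apply bessel_F'_derive, ha).
  destruct (mean_value_open W
    (fun z => - (Rpower z (a - 1) * bessel_F a z * (z * w'' z + a * w' z + w z))) 0 b hb)
    as (z & hz & e).
  - intros z hz. unfold W. evar_last.
    + apply @is_derive_mult; [apply rpow_derive; lra | | intros; apply Rmult_comm].
      apply @is_derive_minus.
      * apply @is_derive_mult;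
          [apply bessel_F'_derive, ha | apply hw, hz | intros; apply Rmult_comm].
      * apply @is_derive_mult;
          [apply bessel_F_derive, ha | apply hw', hz | intros; apply Rmult_comm].
    + unfold plus, minus, opp, mult, plus; simpl. unfold mult; simpl.
      rewrite !rpow_pos_eq by lra. rewrite (Rpower_pred z a) by lra.
      set (P := Rpower z (a - 1)).
      transitivity (P * w z * (z * bessel_F'' a z + a * bessel_F' a z + bessel_F a z)
        - P * bessel_F a z * (z * w'' z + a * w' z + w z)); [ring|].
      rewrite bessel_F_ode by exact ha. ring.
  - intros z hz. unfold W.
    apply (continuous_mult (rpow a)); [apply rpow_continuous, ha|].
    apply (continuous_minus (fun z => bessel_F' a z * w z)).
    + apply (continuous_mult (bessel_F' a)); [apply cF' | apply cw, hz].
    + apply (continuous_mult (bessel_F a)); [apply cF | apply cw', hz].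
  - exists z. split; [exact hz|].
    unfold W in e. rewrite rpow_0, rpow_pos_eq in e by exact hb. lra.
Qed.

(** * The two bounds *)

(** The exponent [c] of the comparison function exceeds 1, so that both [w] and
    [w'] vanish at the right end and the Wronskian does as well. *)
Lemma bessel_F_zero_below (a : R) :
  0 < a -> exists z, 0 < z < a * (a + 2) / 2 /\ bessel_F a z = 0.
Proof.
  intros ha.
  set (b := a * (a + 2) / 2).
  (* [- w'/w = k + c / (b - z)] has the form [g_0 + g_1 z / (1 - z / b)] exactly
     when [c = g_1 b^2] and [k = g_0 - g_1 b]. *)
  set (c := (a + 2) ^ 2 / (4 * (a + 1))).
  set (k := / (2 * (a + 1))).
  assert (hb : 0 < b) by (unfold b; nra).
  assert (hk : 0 < k) by (apply Rinv_0_lt_compat; lra).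
  assert (hc : 0 < c - 1).
  { replace (c - 1) with (a ^ 2 / (4 * (a + 1))) by (unfold c; field; lra).
    apply Rdiv_lt_0_compat; nra. }
  set (w := fun z => exp (- (k * z)) * rpow c (b - z)).
  set (w' := fun z => - (exp (- (k * z)) * (k * rpow c (b - z) + c * rpow (c - 1) (b - z)))).
  set (w'' := fun z => exp (- (k * z)) * (k ^ 2 * rpow c (b - z)
     + 2 * k * c * rpow (c - 1) (b - z) + c * (c - 1) * rpow (c - 1 - 1) (b - z))).
  assert (de : forall z, is_derive (fun z => exp (- (k * z))) z (- k * exp (- (k * z))))
    by (intros z; auto_derive; [exact I | ring]).
  assert (dp : forall p z, z < b ->
    is_derive (fun z => rpow p (b - z)) z (- (p * rpow (p - 1) (b - z)))).
  { intros p z hz. evar_last.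
    - apply (is_derive_comp (rpow p) (fun z => b - z)); [apply rpow_derive; lra|].
      auto_derive; [exact I | reflexivity].
    - unfold scal; simpl; unfold mult; simpl. ring. }
  assert (ce : forall z, continuous (fun z => exp (- (k * z))) z)
    by (intros z; apply (ex_derive_continuous (fun z => exp (- (k * z)))); eexists; apply de).
  assert (cp : forall p z, 0 < p -> continuous (fun z => rpow p (b - z)) z).
  { intros p z hp. apply (continuous_comp (fun z => b - z) (rpow p)).
    - apply (ex_derive_continuous (fun z => b - z)). auto_derive. exact I.
    - apply rpow_continuous, hp. }
  destruct (wronskian_identity a b w w' w'' ha hb) as (z & hz & e).
  - intros z hz. unfold w, w'. evar_last.
    + apply @is_derive_mult; [apply de | apply dp; lra | intros; apply Rmult_comm].
    + unfold plus, mult; simpl; unfold mult; simpl. ring.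
  - intros z hz. unfold w', w''. evar_last.
    + apply @is_derive_opp. apply @is_derive_mult; [apply de | | intros; apply Rmult_comm].
      apply @is_derive_plus; apply is_derive_scal; apply dp; lra.
    + unfold plus, mult, opp; simpl; unfold mult; simpl. ring.
  - intros z _. apply (continuous_mult (fun z => exp (- (k * z)))); [apply ce | apply cp; lra].
  - intros z _. apply (continuous_opp (V := R_NormedModule)
      (fun z => exp (- (k * z)) * (k * rpow c (b - z) + c * rpow (c - 1) (b - z)))).
    apply (continuous_mult (fun z => exp (- (k * z)))); [apply ce|].
    apply (continuous_plus (V := R_NormedModule) (fun z => k * rpow c (b - z))).
    + apply (continuous_scal_r (V := R_NormedModule) k (fun z => rpow c (b - z))), cp; lra.
    + apply (continuous_scal_r (V := R_NormedModule) c (fun z => rpow (c - 1) (b - z))), cp; lra.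
  - exists z. split; [exact hz|].
    assert (ew : w b = 0) by (unfold w; rewrite Rminus_diag, rpow_0; ring).
    assert (ew' : w' b = 0) by (unfold w'; rewrite Rminus_diag, !rpow_0; ring).
    rewrite ew, ew' in e.
    assert (eq : z * w'' z + a * w' z + w z
                 = k ^ 2 * z ^ 3 * exp (- (k * z)) * Rpower (b - z) (c - 1 - 1)).
    { unfold w, w', w''. rewrite !rpow_pos_eq by lra.
      rewrite (Rpower_pred (b - z) c), (Rpower_pred (b - z) (c - 1)) by lra.
      set (E := exp _). set (P := Rpower _ _).
      transitivity (E * P * (z * (k ^ 2 * (b - z) ^ 2 + 2 * k * c * (b - z) + c * (c - 1))
         - a * (k * (b - z) ^ 2 + c * (b - z)) + (b - z) ^ 2)); [ring|].
      transitivity (E * P * (k ^ 2 * z ^ 3)); [|ring].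
      f_equal. unfold b, c, k. field. lra. }
    rewrite eq in e.
    assert (hp : 0 < b * Rpower z (a - 1)
      * (k ^ 2 * z ^ 3 * exp (- (k * z)) * Rpower (b - z) (c - 1 - 1))).
    { assert (0 < z) by lra.
      repeat apply Rmult_lt_0_compat; try apply pow_lt; try apply exp_pos; lra. }
    apply Rmult_eq_reg_l with (2 := Rgt_not_eq _ _ hp). lra.
Qed.

(** In the scaled variable [t = x / b], with [X = g_0 b] and [Y = g_1 b^2], the
    recurrence of the Rayleigh sums reads [X^2 = (a + 1) Y] and
    [2 X Y = a + 2]; every sign follows from it and from [1 < Y < X]. *)
Lemma bessel_F_zero_above (a b z : R) :
  0 < a -> 0 < b -> b ^ 3 = a ^ 3 * (a + 1) * (a + 2) / 2 ->
  0 < z -> bessel_F a z = 0 -> (forall x, 0 <= x < z -> 0 < bessel_F a x) ->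
  b < z.
Proof.
  intros ha hb eb hz hfz hpos. apply Rnot_le_lt. intros hzb.
  (* [F] reaches its first zero with negative slope: compare with [w = 1]. *)
  assert (hF' : bessel_F' a z < 0).
  { destruct (wronskian_identity a z (fun _ => 1) (fun _ => 0) (fun _ => 0) ha hz)
      as (x & hx & e).
    - intros; apply @is_derive_const.
    - intros; apply @is_derive_const.
    - intros; apply continuous_const.
    - intros; apply continuous_const.
    - specialize (hpos x ltac:(lra)).
      assert (0 < z * Rpower x (a - 1) * bessel_F a x)
        by (repeat apply Rmult_lt_0_compat; try apply Rpower_pos; lra).
      generalize (Rpower_pos z a). intros. nra. }
  (* In [- w'/w = k + m x + 1 / (b - x)], the constants [k] and [m] are such that
     the terms in [1] and [x] are those [g_0 + g_1 x] of [- F'/F]; the value of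
     [b] makes the term in [x^2] agree too. *)
  set (k := / a - / b).
  set (m := / (a ^ 2 * (a + 1)) - / b ^ 2).
  set (w := fun z => (b - z) * exp (- (k * z + m * z ^ 2 / 2))).
  set (w' := fun z => - (1 + (k + m * z) * (b - z)) * exp (- (k * z + m * z ^ 2 / 2))).
  set (w'' := fun z => ((k + m * z) * (1 + (k + m * z) * (b - z)) + (k + m * z) - m * (b - z))
    * exp (- (k * z + m * z ^ 2 / 2))).
  assert (dw : forall x, is_derive w x (w' x))
    by (intros x; unfold w, w'; auto_derive; [exact I|unfold Rdiv, Rminus; simpl; field]).
  assert (dw' : forall x, is_derive w' x (w'' x))
    by (intros x; unfold w', w''; auto_derive; [exact I|unfold Rdiv, Rminus; simpl; field]).
  destruct (wronskian_identity a z w w' w'' ha hz) as (x & hx & e).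
  - intros; apply dw.
  - intros; apply dw'.
  - intros; apply (ex_derive_continuous w); eexists; apply dw.
  - intros; apply (ex_derive_continuous w'); eexists; apply dw'.
  - rewrite hfz in e.
    set (X := b / a). set (Y := b ^ 2 / (a ^ 2 * (a + 1))). set (t := x / b).
    assert (eX : X ^ 2 = (a + 1) * Y) by (unfold X, Y; field; lra).
    assert (eXY : 2 * X * Y = a + 2).
    { transitivity (2 * b ^ 3 / (a ^ 3 * (a + 1))); [unfold X, Y; field; lra|].
      rewrite eb. field. lra. }
    assert (hX0 : 0 < X) by (apply Rdiv_lt_0_compat; lra).
    assert (eY : Y ^ 3 = (a + 2) ^ 2 / (4 * (a + 1))).
    { transitivity ((b ^ 3) ^ 2 / (a ^ 6 * (a + 1) ^ 3)); [unfold Y; field; lra|].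
      rewrite eb. field. lra. }
    assert (hY0 : 0 < Y) by (apply Rdiv_lt_0_compat; nra).
    assert (hY : 1 < Y).
    { apply Rnot_le_lt. intros h.
      assert (h3 : Y ^ 3 <= 1) by (rewrite <- (pow1 3); apply pow_incr; lra).
      assert (0 < a ^ 2 / (4 * (a + 1))) by (apply Rdiv_lt_0_compat; nra).
      assert (Y ^ 3 - 1 = a ^ 2 / (4 * (a + 1))) by (rewrite eY; field; lra).
      lra. }
    assert (hXY : Y < X) by nra.
    assert (ht : 0 < t < 1).
    { unfold t. split; [apply Rdiv_lt_0_compat; lra|].
      apply Rmult_lt_reg_r with b; [exact hb|]. unfold Rdiv.
      rewrite Rmult_assoc, Rinv_l; lra. }
    set (E := exp (- (k * x + m * x ^ 2 / 2))).
    assert (eq : x * w'' x + a * w' x + w x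
        = - (E * ((Y - 1) * t ^ 3 * ((2 * X - Y - 1) * (1 - t) + 2 * (X - 1) * t)))).
    { unfold w, w', w''. fold E.
      set (u := X - 1 + (Y - 1) * t).
      transitivity (E * (t * (u * (2 + u * (1 - t)) - (Y - 1) * (1 - t))
         - a * (1 + u * (1 - t)) + a * X * (1 - t))).
      - replace (k + m * x) with (u / b)
          by (unfold u, k, m, X, Y, t; field; lra).
        replace m with ((Y - 1) / b ^ 2) by (unfold m, Y; field; lra).
        replace x with (b * t) by (unfold t; field; lra).
        replace (a * X) with b by (unfold X; field; lra).
        field. lra.
      - (* The two sides differ by a multiple of [X^2 - (a + 1) Y]. *)
        replace a with (2 * X * Y - 2) in eX |- * by lra.
        transitivity (- (E * ((Y - 1) * t ^ 3 * ((2 * X - Y - 1) * (1 - t) + 2 * (X - 1) * t)))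
          + E * (t - t ^ 2) * (X ^ 2 - (2 * X * Y - 2 + 1) * Y));
          [unfold u; ring | rewrite eX; ring]. }
    rewrite eq in e.
    assert (hl : 0 <= Rpower z a * (- bessel_F' a z * w z)).
    { apply Rmult_le_pos; [left; apply Rpower_pos|].
      apply Rmult_le_pos; [lra|].
      apply Rmult_le_pos; [lra | left; apply exp_pos]. }
    assert (hr : 0 < z * Rpower x (a - 1) * bessel_F a x
        * (E * ((Y - 1) * t ^ 3 * ((2 * X - Y - 1) * (1 - t) + 2 * (X - 1) * t)))).
    { apply Rmult_lt_0_compat.
      - repeat apply Rmult_lt_0_compat; [lra | apply Rpower_pos | apply hpos; lra].
      - apply Rmult_lt_0_compat; [apply exp_pos|].
        apply Rmult_lt_0_compat; [apply Rmult_lt_0_compat; [lra | apply pow_lt; lra]|].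
        apply Rplus_lt_0_compat; apply Rmult_lt_0_compat; lra. }
    lra.
Qed.

Theorem corollary2 (nu : R) (hnu : -1 < nu) :
  exists j : R, is_first_positive_zero nu j /\
    Rpower 2 (5 / 6) * sqrt (nu + 1) * Rpower ((nu + 2) * (nu + 3)) (1 / 6) < j /\
    j < sqrt (2 * (nu + 1) * (nu + 3)).
Proof.
  set (a := nu + 1).
  assert (ha : 0 < a) by (unfold a; lra).
  destruct (bessel_F_zero_below a ha) as (z0 & hz0 & e0).
  destruct (first_zero (bessel_F a) z0) as (z & hz & ez & hpos).
  - intros x. apply (ex_derive_continuous (bessel_F a)). eexists. apply bessel_F_derive, ha.
  - rewrite bessel_F_0. lra.
  - lra.
  - exact e0.
  - set (L := Rpower 2 (5 / 6) * sqrt a * Rpower ((nu + 2) * (nu + 3)) (1 / 6)).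
    assert (hs : 0 < sqrt z) by (apply sqrt_lt_R0; lra).
    assert (es : sqrt z ^ 2 = z) by (apply pow2_sqrt; lra).
    assert (hL : 0 < L).
    { repeat apply Rmult_lt_0_compat; try apply Rpower_pos. apply sqrt_lt_R0, ha. }
    assert (eL : L ^ 6 = 32 * a ^ 3 * ((a + 1) * (a + 2))).
    { assert (e6 : forall x p, 0 < x -> Rpower x p ^ 6 = Rpower x (p * 6)).
      { intros x p hx. rewrite <- Rpower_pow by apply Rpower_pos.
        rewrite Rpower_mult. f_equal. simpl. ring. }
      unfold L. rewrite !Rpow_mult_distr, !e6 by nra.
      replace (5 / 6 * 6) with (INR 5) by (simpl; field).
      replace (1 / 6 * 6) with 1 by field.
      rewrite Rpower_pow, Rpower_1 by nra.
      replace (sqrt a ^ 6) with ((sqrt a ^ 2) ^ 3) by ring.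
      rewrite pow2_sqrt by lra. unfold a. ring. }
    exists (2 * sqrt z). repeat split.
    + lra.
    + apply BesselJ_zero_iff; [exact hnu | lra |].
      replace ((2 * sqrt z) ^ 2 / 4) with (sqrt z ^ 2) by field.
      rewrite es. exact ez.
    + intros x hx hJ. apply BesselJ_zero_iff in hJ; [|exact hnu | exact hx].
      apply Rnot_lt_le. intros hlt.
      specialize (hpos (x ^ 2 / 4) ltac:(nra)). fold a in hJ. lra.
    + assert (hlow : L ^ 2 / 4 < z).
      { apply bessel_F_zero_above with a; try assumption; try lra; nra. }
      apply Rnot_le_lt. intros hle. nra.
    + replace (2 * sqrt z) with (sqrt (4 * z)).
      * apply sqrt_lt_1; unfold a in *; nra.
      * rewrite sqrt_mult by lra. f_equal. replace 4 with (2 * 2) by ring.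
        apply sqrt_square. lra.
Qed.
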